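(* Let $\Omega$ be a Hausdorff space, $X$ be a complex Banach space, and $A$ be the base algebra of $A(\Omega,X)$. Suppose that the set $\rho A$ of strong peak points for $A$ is a norming subset of $\Omega$. Then $n_L(X)\le n_L(A(\Omega,X))$.
   Context: All Banach spaces are complex. $C_b(\Omega,X)$ is the Banach space of bounded continuous functions $\Omega\to X$ with the supremum norm, and $C_b(\Omega)=C_b(\Omega,\mathbb{C})$. A function algebra on $\Omega$ is a closed subspace (subalgebra) of $C_b(\Omega)$ that separates the points of $\Omega$ and contains the constants. $A(\Omega,X)$ denotes a closed subspace of $C_b(\Omega,X)$ such that: (i) the base algebra $A=\{x^*\circ f: f\in A(\Omega,X),\ x^*\in X^*\}$ is a function algebra; (ii) $A\otimes X\subset A(\Omega,X)$ (i.e. $t\mapsto\varphi(t)x$ is in $A(\Omega,X)$ for $\varphi\in A$, $x\in X$); (iii) $fg\in A(\Omega,X)$ for every $f\in A$, $g\in A(\Omega,X)$. A point $t_0\in\Omega$ is a strong peak point for $A$ if there is $f\in A$ with $|f(t_0)|=\|f\|_\infty$ and $\sup_{t\in\Omega\setminus U}|f(t)|<\|f\|_\infty$ for every open neighborhood $U$ of $t_0$; $\rho A$ is the set of strong peak points. $\rho A$ is norming if $\|f\|=\sup_{t\in\rho A}|f(t)|$ for all $f\in A$ (equivalently $\|f\|=\sup_{t\in\rho A}\|f(t)\|$ for all $f\in A(\Omega,X)$). For a Banach space $Z$, $\mathrm{Lip}_0(Z,Z)$ is the space of Lipschitz maps $T:Z\to Z$ with $T(0)=0$ and norm $\|T\|_L=\sup_{x\ne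 y}\|Tx-Ty\|/\|x-y\|$; $D(z)=\{z^*\in Z^*: z^*(z)=\|z^*\|\|z\|=\|z\|^2\}$; $\nu_L(T)=\sup\left\{\frac{|z^*(Tx-Ty)|}{\|x-y\|^2}: x\ne y \text{ in } Z,\ z^*\in D(x-y)\right\}$; and $n_L(Z)=\inf\{\nu_L(T): T\in\mathrm{Lip}_0(Z,Z),\ \|T\|_L=1\}$. *)

(* Defs.v *)
From HB Require Import structures.
From mathcomp Require Import all_boot all_order all_algebra.
From mathcomp Require Import complex.
From mathcomp Require Import all_classical all_reals all_analysis.

Set Implicit Arguments.
Unset Strict Implicit.
Unset Printing Implicit Defensive.

Import Order.TTheory GRing.Theory Num.Theory.
Import numFieldNormedType.Exports.

Local Open Scope classical_set_scope.
Local Open Scope ring_scope.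
Local Open Scope complex_scope.

(* The norm of a normed module over R[i] takes its values in R[i] (they are
   nonnegative, hence have zero imaginary part); rnorm reads it in R. *)
Definition rnorm (R : realType) (V : normedModType R[i]) (v : V) : R :=
  complex.Re `|v|.

Section rnorm_lemmas.
Context {R : realType} {V : normedModType R[i]}.
Implicit Types v w : V.

Lemma rnormE v : (rnorm v)%:C = `|v|.
Proof. by rewrite /rnorm RRe_real// ger0_real. Qed.

Lemma rnorm_ge0 v : 0 <= rnorm v.
Proof. by rewrite -(@lecR R) rnormE normr_ge0. Qed.

Lemma rnorm0 : rnorm (0 : V) = 0.
Proof. by apply: (@complexI R); rewrite rnormE normr0. Qed.

Lemma rnorm_eq0 v : rnorm v = 0 -> v = 0.
Proof. by move=> v0; apply: normr0_eq0; rewrite -rnormE v0. Qed.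

Lemma ler_rnormD v w : rnorm (v + w) <= rnorm v + rnorm w.
Proof. by rewrite -(@lecR R) rmorphD/= !rnormE ler_normD. Qed.

Lemma rnormZ (a : R[i]) v : rnorm (a *: v) = complex.Re `|a| * rnorm v.
Proof.
apply: (@complexI R); rewrite rmorphM/= [RHS]mulrC !rnormE normrZ mulrC.
by rewrite ?RRe_real// ger0_real.
Qed.

End rnorm_lemmas.

Section Cb_type.
Context {R : realType} (Omega : topologicalType) (X : normedModType R[i]).

Definition Cb_pred : {pred Omega -> X} :=
  fun f => `[< continuous f /\ bounded_fun f >].

Lemma bounded_rnormP (f : Omega -> X) :
  bounded_fun f <-> exists M : R, forall t, rnorm (f t) <= M.
Proof.
split.
  move=> /pinfty_ex_gt0[M M0 fM]; exists (complex.Re M) => t.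
  by rewrite -(@lecR R) rnormE RRe_real ?gtr0_real//; exact: fM.
move=> [M fM]; exists M%:C; split; first by rewrite complex_real.
by move=> N MN t _ /=; rewrite -rnormE (le_trans _ (ltW MN))// lecR.
Qed.

Lemma Cb_submod_closed : submod_closed Cb_pred.
Proof.
split.
  apply/asboolP; split; first by move=> t; exact: cst_continuous.
  by apply/bounded_rnormP; exists 0 => t; rewrite rnorm0.
move=> a f g /asboolP[cf /bounded_rnormP[M fM]].
move=> /asboolP[cg /bounded_rnormP[N gN]]; apply/asboolP; split.
  move=> t; apply: (@continuousD _ _ _ (a \*: f) g); last exact: cg.
  by apply: continuousZr; exact: cf.
apply/bounded_rnormP; exists (complex.Re `|a| * M + N) => t.
rewrite (le_trans (ler_rnormD _ _))// lerD// rnormZ ler_wpM2l//.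
by have := @rnorm_ge0 R (R[i]^o) a.
Qed.

HB.instance Definition _ :=
  GRing.isSubmodClosed.Build R[i] (Omega -> X) Cb_pred Cb_submod_closed.

Record Cb := MkCb { Cb_fun :> Omega -> X ; Cb_funP : Cb_fun \in Cb_pred }.

HB.instance Definition _ := [isSub for Cb_fun].
HB.instance Definition _ := [Choice of Cb by <:].
HB.instance Definition _ := [SubChoice_isSubLmodule of Cb by <:].

Lemma Cb_continuous (f : Cb) : continuous f.
Proof. by case: f => f /= /asboolP[]. Qed.

Lemma Cb_bounded (f : Cb) : bounded_fun f.
Proof. by case: f => f /= /asboolP[]. Qed.

Definition supnorm (f : Cb) : R := sup [set rnorm (f t) | t in setT].

Lemma supnorm_ubound (f : Cb) : has_ubound [set rnorm (f t) | t in setT].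
Proof.
by have /bounded_rnormP[M fM] := Cb_bounded f; exists M => _ [t _ <-].
Qed.

Lemma supnorm_ub (f : Cb) t : rnorm (f t) <= supnorm f.
Proof. by apply: ub_le_sup; [exact: supnorm_ubound | exists t]. Qed.

Lemma supnorm_le (f : Cb) M :
  0 <= M -> (forall t, rnorm (f t) <= M) -> supnorm f <= M.
Proof.
move=> M0 fM; rewrite /supnorm.
have [->|/set0P ne] := eqVneq [set rnorm (f t) | t in setT] set0.
  by rewrite sup0.
by apply: ge_sup => // _ [t _ <-].
Qed.

Lemma supnorm_ge0 (f : Cb) : 0 <= supnorm f.
Proof.
have [e|/set0P[_ [t _ _]]] := eqVneq [set rnorm (f t) | t in setT] set0.
  by rewrite /supnorm e sup0.
by rewrite (le_trans _ (supnorm_ub f t))// rnorm_ge0.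
Qed.

Let Cb_norm (f : Cb) : R[i] := (supnorm f)%:C.

Let ler_Cb_normD f g : Cb_norm (f + g) <= Cb_norm f + Cb_norm g.
Proof.
rewrite /Cb_norm -rmorphD lecR; apply: supnorm_le => [|t].
  by rewrite addr_ge0 ?supnorm_ge0.
by rewrite (le_trans (ler_rnormD _ _))// lerD ?supnorm_ub.
Qed.

Let Cb_norm_eq0 f : Cb_norm f = 0 -> f = 0.
Proof.
move=> /(@complexI R) f0; apply/val_inj/funext => t /=; apply: rnorm_eq0.
by apply/eqP; rewrite eq_le rnorm_ge0 -f0 supnorm_ub.
Qed.

Let Re_norm_ge0 (a : R[i]) : 0 <= complex.Re `|a|.
Proof. exact: (@rnorm_ge0 R (R[i]^o) a). Qed.

Let normE (a : R[i]) : (complex.Re `|a|)%:C = `|a|.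
Proof. exact: (@rnormE R (R[i]^o) a). Qed.

Let Cb_normZ a f : Cb_norm (a *: f) = `|a| * Cb_norm f.
Proof.
have le_norm (b : R[i]) g : supnorm (b *: g) <= complex.Re `|b| * supnorm g.
  apply: supnorm_le => [|t]; first by rewrite mulr_ge0 ?supnorm_ge0.
  by rewrite [(b *: g) t]/(b *: g t) rnormZ ler_wpM2l ?supnorm_ub.
suff eq_norm : supnorm (a *: f) = complex.Re `|a| * supnorm f.
  by rewrite /Cb_norm eq_norm rmorphM; congr (_ * _); exact: normE.
have [->|a0] := eqVneq a 0.
  apply/eqP; rewrite eq_le le_norm normr0/= mul0r supnorm_ge0//.
apply/eqP; rewrite eq_le le_norm/=.
have a1 : complex.Re `|a| * complex.Re `|a^-1| = 1.
  apply: (@complexI R); transitivity (`|a| * `|a^-1|).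
    by rewrite rmorphM; congr (_ * _); exact: normE.
  by rewrite -normrM divff// normr1.
have := le_norm a^-1 (a *: f); rewrite scalerA mulVf// scale1r.
by move=> /(ler_wpM2l (Re_norm_ge0 a)); rewrite mulrA a1 mul1r.
Qed.

HB.instance Definition _ :=
  Lmodule_isNormed.Build R[i] Cb ler_Cb_normD Cb_normZ Cb_norm_eq0.

Lemma Cb_normE (f : Cb) : `|f| = (supnorm f)%:C.
Proof. by []. Qed.

End Cb_type.

Arguments Cb {R} Omega X.

Section sub_normed.
Context {K : numFieldType} {V : normedModType K}.

Record sub_normed (S : submodClosed V) :=
  SubNormed { sub_val : V ; sub_valP : sub_val \in S }.

Variable S : submodClosed V.

HB.instance Definition _ := [isSub for @sub_val S].
HB.instance Definition _ := [Choice of sub_normed S by <:].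
HB.instance Definition _ := [SubChoice_isSubLmodule of sub_normed S by <:].

Let sub_norm (v : sub_normed S) : K := `|val v|.

Let ler_sub_normD v w : sub_norm (v + w) <= sub_norm v + sub_norm w.
Proof. exact: ler_normD. Qed.

Let sub_normZ a v : sub_norm (a *: v) = `|a| * sub_norm v.
Proof. exact: normrZ. Qed.

Let sub_norm_eq0 v : sub_norm v = 0 -> v = 0.
Proof. by move=> /normr0_eq0 v0; exact/val_inj. Qed.

HB.instance Definition _ := Lmodule_isNormed.Build K (sub_normed S)
  ler_sub_normD sub_normZ sub_norm_eq0.

End sub_normed.

Section Lipschitz_numerical_index.
Context {R : realType}.

Definition dual (Z : normedModType R[i]) : set {linear Z -> R[i]^o} :=
  [set zs | continuous zs].

Definition dual_norm (Z : normedModType R[i]) (zs : {linear Z -> R[i]^o}) : R :=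
  sup [set rnorm (zs z) | z in [set z | rnorm z <= 1]].

Definition D (Z : normedModType R[i]) (z : Z) : set {linear Z -> R[i]^o} :=
  [set zs | [/\ dual zs, zs z = (dual_norm zs * rnorm z)%:C
              & dual_norm zs * rnorm z = rnorm z ^+ 2]].

Definition Lip0 (Z : normedModType R[i]) : set (Z -> Z) :=
  [set T | lipschitz T /\ T 0 = 0].

Definition lip_norm (Z : normedModType R[i]) (T : Z -> Z) : R :=
  sup [set r | exists x y : Z, x <> y /\ r = rnorm (T x - T y) / rnorm (x - y)].

Definition nuL (Z : normedModType R[i]) (T : Z -> Z) : R :=
  sup [set r | exists (x y : Z) (zs : {linear Z -> R[i]^o}),
    [/\ x <> y, D (x - y) zs
      & r = rnorm (zs (T x - T y)) / rnorm (x - y) ^+ 2]].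

(* The infimum is taken in the extended reals: when Z = {0}, no map has
   Lipschitz norm 1 and the infimum over the empty set is +oo. *)
Definition nL (Z : normedModType R[i]) : \bar R :=
  ereal_inf [set (nuL T)%:E | T in [set T : Z -> Z | Lip0 T /\ lip_norm T = 1]].

End Lipschitz_numerical_index.

Section function_spaces.
Context {R : realType} {Omega : topologicalType}.

Lemma Cb_mul_subproof (X : normedModType R[i])
    (phi : Cb Omega R[i]^o) (f : Cb Omega X) :
  (fun t => phi t *: f t) \in @Cb_pred R Omega X.
Proof.
apply/asboolP; split.
  by move=> t; apply: continuousZ; exact: Cb_continuous.
apply/bounded_rnormP; exists (supnorm phi * supnorm f) => t.
rewrite rnormZ ler_pM ?supnorm_ub ?rnorm_ge0//.
- exact: (@rnorm_ge0 R (R[i]^o) (phi t)).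
- exact: (supnorm_ub phi t).
Qed.

Definition Cb_mul (X : normedModType R[i])
    (phi : Cb Omega R[i]^o) (f : Cb Omega X) : Cb Omega X :=
  MkCb (Cb_mul_subproof phi f).

Lemma Cb_cst_subproof (X : normedModType R[i]) (x : X) :
  (fun _ => x) \in @Cb_pred R Omega X.
Proof.
apply/asboolP; split; first by move=> t; exact: cst_continuous.
by apply/bounded_rnormP; exists (rnorm x).
Qed.

Definition Cb_cst (X : normedModType R[i]) (x : X) : Cb Omega X :=
  MkCb (Cb_cst_subproof x).

Definition function_algebra (A : set (Cb Omega R[i]^o)) : Prop :=
  [/\ closed A,
      (forall (a : R[i]) f g, A f -> A g -> A (a *: f + g)),
      (forall f g, A f -> A g -> A (Cb_mul f g)),
      (forall s t : Omega, s <> t -> exists2 f, A f & f s <> f t)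
    & (forall c : R[i], A (Cb_cst (c : R[i]^o)))].

Definition base_algebra (X : normedModType R[i]) (S : set (Cb Omega X)) :
    set (Cb Omega R[i]^o) :=
  [set phi | exists (f : Cb Omega X) (xs : {linear X -> R[i]^o}),
    [/\ S f, dual xs & forall t, phi t = xs (f t)]].

(* phi (x) x, the map t |-> phi t *: x, is Cb_mul phi (Cb_cst x). *)
Definition A_space (X : normedModType R[i]) (S : set (Cb Omega X)) : Prop :=
  [/\ closed S,
      function_algebra (base_algebra S),
      (forall phi (x : X), base_algebra S phi -> S (Cb_mul phi (Cb_cst x)))
    & (forall phi g, base_algebra S phi -> S g -> S (Cb_mul phi g))].

Definition strong_peak_points (A : set (Cb Omega R[i]^o)) : set Omega :=
  [set t0 | exists f, [/\ A f, rnorm (f t0) = rnorm f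
    & forall U : set Omega, open U -> U t0 ->
        sup [set rnorm (f t) | t in ~` U] < rnorm f]].

Definition norming (A : set (Cb Omega R[i]^o)) (G : set Omega) : Prop :=
  forall f, A f -> rnorm f = sup [set rnorm (f t) | t in G].

End function_spaces.

(* Main.v *)
(** Let T be a Lipschitz map of A(Omega,X) with norm 1 that almost attains its
norm on the pair f, g. The points of rho A are norming for vector-valued
functions as well (Hahn-Banach), so Tf - Tg is almost as large as f - g at some
strong peak point t0. Let k = f - g and r = ||k||. A peak function phi at t0,
concentrated near t0 and with values in a thin Stolz region
|w| + (1 - eps)|1 - w| <= 1, gives an isometric, non-linear section
  Psi x = phi x + (1 - eps) (||x|| / r) (1 - phi) k
of the evaluation at t0. If p + q = k(t0) and ||p|| + ||q|| = r, then
g + Psi p + Psi q is close to f, so T almost attains its norm at t0 on one of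
the two steps g -> g + Psi p -> g + Psi p + Psi q. Starting from the beginning a
of that step, S x = T(a + Psi x)(t0) - T(a)(t0) is a Lipschitz map of X whose
norm is almost 1 and whose numerical radius is at most that of T. *)

Require Import Defs.
From HB Require Import structures.
From mathcomp Require Import all_boot all_order all_algebra.
From mathcomp Require Import complex ring lra.
From mathcomp Require Import all_classical all_reals all_analysis.
Set Implicit Arguments.
Unset Strict Implicit.
Unset Printing Implicit Defensive.
Import Order.TTheory GRing.Theory Num.Theory.
Import numFieldNormedType.Exports.
Local Open Scope classical_set_scope.
Local Open Scope ring_scope.
Local Open Scope complex_scope.

(** * The Hahn-Banach theorem *)

Section hahn_banach.
Context {R : realType} {V : lmodType R[i]}.
Implicit Types (p q : V -> R) (v w y : V).

(** The complex space is read as a real one through [%:C]. Homogeneity is only an inequality, the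
    form that passes most easily to infima; equality is recovered in [sublinearZ]. *)
Definition sublinear p :=
  (forall v w, p (v + w) <= p v + p w) /\
  (forall (a : R) v, 0 <= a -> p (a%:C *: v) <= a * p v).

Lemma sublinear0 p : sublinear p -> p 0 = 0.
Proof.
move=> [pD pZ]; have := pZ 0 0 (lexx 0); have := pD 0 0.
rewrite addr0 scaler0 mul0r; lra.
Qed.

Lemma sublinearZ p (a : R) v : sublinear p -> 0 <= a -> p (a%:C *: v) = a * p v.
Proof.
move=> sp; have [pD pZ] := sp; rewrite le_eqVlt => /orP[/eqP<-|a0].
  by rewrite mul0r scale0r sublinear0.
apply/eqP; rewrite eq_le (pZ _ _ (ltW a0))/=.
have := pZ a^-1 (a%:C *: v); rewrite invr_ge0 ltW// => /(_ isT).
rewrite scalerA -rmorphM mulVf ?gt_eqF// scale1r => h.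
by have := ler_wpM2l (ltW a0) h; rewrite mulrA divff ?gt_eqF// mul1r.
Qed.

Lemma sublinear_ge p v : sublinear p -> - p (- v) <= p v.
Proof.
move=> sp; have [pD _] := sp.
by have := pD v (- v); rewrite subrr sublinear0//; lra.
Qed.

(** For sublinear [p], this is the largest sublinear minorant of [p] whose value at [- y] is at most
    [- p y]. *)
Definition inf_translate p y v : R :=
  inf [set p (v + t%:C *: y) - t * p y | t in [set t : R | 0 <= t]].

(** Subadditivity applied to [t y = (v + t y) + (- v)]. It keeps the real [inf] away from its
    default value on sets unbounded below. *)
Lemma inf_translate_lb p y v : sublinear p ->
  lbound [set p (v + t%:C *: y) - t * p y | t in [set t : R | 0 <= t]]
    (- p (- v)).
Proof.
move=> sp _ [t /= t0 <-]; have [pD _] := sp.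
have := pD (v + t%:C *: y) (- v); rewrite addrAC subrr add0r sublinearZ//.
lra.
Qed.

Lemma inf_translate_ge p y v M :
  (forall t : R, 0 <= t -> M <= p (v + t%:C *: y) - t * p y) ->
  M <= inf_translate p y v.
Proof.
move=> h; apply: lb_le_inf; last by move=> _ [t /= t0 <-]; exact: h.
by exists (p (v + 0%:C *: y) - 0 * p y), 0 => /=.
Qed.

Lemma inf_translate_le p y v (t : R) : sublinear p -> 0 <= t ->
  inf_translate p y v <= p (v + t%:C *: y) - t * p y.
Proof.
move=> sp t0; apply: ge_inf; last by exists t.
by exists (- p (- v)); exact: inf_translate_lb.
Qed.

Lemma inf_translate_le_id p y v : sublinear p -> inf_translate p y v <= p v.
Proof.
move=> sp; have := inf_translate_le y v sp (lexx 0).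
by rewrite scale0r addr0 mul0r subr0.
Qed.

Lemma inf_translateN p y : sublinear p -> inf_translate p y (- y) <= - p y.
Proof.
move=> sp; have := inf_translate_le y (- y) sp ler01.
by rewrite scale1r addNr sublinear0// mul1r add0r.
Qed.

Lemma inf_translate_sublinear p y :
  sublinear p -> sublinear (inf_translate p y).
Proof.
move=> sp; have [pD pZ] := sp; split.
  move=> v w; rewrite -lerBlDr; apply: inf_translate_ge => s s0.
  rewrite lerBlDr -lerBlDl; apply: inf_translate_ge => t t0.
  (* Parameters [s] for [v] and [t] for [w] combine into [s + t] for [v + w]. *)
  rewrite lerBlDl (le_trans (inf_translate_le y _ sp (addr_ge0 s0 t0)))//.
  have := pD (v + s%:C *: y) (w + t%:C *: y).
  rewrite rmorphD scalerDl addrACA; lra.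
move=> a v; rewrite le_eqVlt => /orP[/eqP<-|a0].
  by rewrite mul0r scale0r (le_trans (inf_translate_le_id _ _ sp))// sublinear0.
rewrite mulrC -ler_pdivrMr//; apply: inf_translate_ge => t t0.
have at0 := mulr_ge0 (ltW a0) t0.
rewrite ler_pdivrMr// (le_trans (inf_translate_le y _ sp at0))//.
rewrite rmorphM -scalerA -scalerDr (sublinearZ _ sp (ltW a0)); lra.
Qed.

(* Any sublinear functional dominates a minimal one, and minimality forces
   [inf_translate p y = p], which is additivity. *)
Lemma sublinear_minorant q : sublinear q ->
  exists g : V -> R, [/\ forall v, g v <= q v, {morph g : v w / v + w}
    & forall (a : R) v, g (a%:C *: v) = a * g v].
Proof.
move=> sq; pose P p := sublinear p /\ forall v, p v <= q v.
(* The pointwise order is reversed, so that a maximal element in Zorn's lemma is a minimal sublinear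
   minorant of [q]. *)
pose Q (p p' : {p | P p}) := `[< forall v, sval p' v <= sval p v >].
have [|||A Atot|[p [sp pq]] pmin] := @Zorn _ Q.
- by move=> p; apply/asboolP.
- move=> a b c /asboolP ab /asboolP bc; apply/asboolP => v.
  exact: le_trans (bc v) (ab v).
- move=> [a Pa] [b Pb] /asboolP/= ab /asboolP/= ba; apply: eq_exist.
  by apply/funext => v; apply/eqP; rewrite eq_le ab ba.
- have [A0|/set0P[p0 Ap0]] := eqVneq A set0.
    have Pq : P q by split.
    by exists (exist _ q Pq) => s; rewrite A0.
  pose m v := inf [set sval p v | p in A].
  have m_le (p : {p | P p}) v : A p -> m v <= sval p v.
    move=> Ap; apply: ge_inf; last by exists p.
    exists (- q (- v)) => _ [[p' [sp' pq']] _ <-] /=.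
    by have := sublinear_ge v sp'; have := pq' (- v); lra.
  have m_ge M v : (forall p : {p | P p}, A p -> M <= sval p v) -> M <= m v.
    move=> h; apply: lb_le_inf; first by exists (sval p0 v), p0.
    by move=> _ [p Ap <-]; exact: h.
  have Pm : P m.
    split; last first.
      move=> v; rewrite (le_trans (m_le p0 v Ap0))//.
      by case: (p0) => ? [].
    split.
      move=> v w; rewrite -lerBlDr; apply: (m_ge) => p Ap.
      rewrite lerBlDr -lerBlDl; apply: (m_ge) => p' Ap'.
      (* Subadditivity of the infimum relies on the chain: the smaller of [p] and [p'] bounds both
         terms at once. *)
      rewrite lerBlDl; have [/asboolP pp'|/asboolP pp'] := Atot p p' Ap Ap'.
        rewrite (le_trans (m_le p' _ Ap'))//.
        case: (p') pp' => p'' [[p''D _] _] /= pp'.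
        by have := p''D v w; have := pp' v; lra.
      rewrite (le_trans (m_le p _ Ap))//.
      case: (p) pp' => p'' [[p''D _] _] /= pp'.
      by have := p''D v w; have := pp' w; lra.
    move=> a v; rewrite le_eqVlt => /orP[/eqP<-|a0].
      rewrite mul0r scale0r (le_trans (m_le p0 _ Ap0))//.
      by case: (p0) => ? [/sublinear0 e _] /=; rewrite e.
    rewrite [leRHS]mulrC -ler_pdivrMr//; apply: (m_ge) => p Ap.
    rewrite ler_pdivrMr// (le_trans (m_le p _ Ap))// [leRHS]mulrC.
    by case: (p) => ? [[_ h] _] /=; rewrite h ?ltW.
  by exists (exist _ m Pm) => p Ap; apply/asboolP => v; exact: m_le.
have pD : {morph p : v w / v + w}.
  move=> v y; apply/eqP; rewrite eq_le (sp.1 v y)/=.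
  have Pt : P (inf_translate p y).
    split; first exact: inf_translate_sublinear.
    by move=> w; rewrite (le_trans (inf_translate_le_id _ _ sp)).
  have := pmin (exist _ _ Pt); rewrite /Q/= => h.
  have /(congr1 sval)/= e := h (introT (asboolP _)
    (fun w => inf_translate_le_id y w sp)).
  (* With [inf_translate p y = p], the parameter [t = 1] gives [p v + p y <= p (v + y)]. *)
  have := inf_translate_le y v sp ler01.
  by rewrite e scale1r mul1r; lra.
have pN v : p (- v) = - p v.
  by apply/eqP; rewrite -addr_eq0 -pD addNr sublinear0.
exists p; split=> // a v.
have [a0|/ltW a0] := leP 0 a; first exact: sublinearZ.
rewrite -[a]opprK rmorphN scaleNr pN sublinearZ ?oppr_ge0//; lra.
Qed.

End hahn_banach.

(** * Real-valued norms, bounded operators and norm-attaining functionals *)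

Lemma rnorm_complexE {R : realType} (z : R[i]) :
  rnorm (z : R[i]^o) = complex.Re `|z|.
Proof. by []. Qed.

Lemma ler_Re_rnorm {R : realType} (z : R[i]) :
  complex.Re z <= rnorm (z : R[i]^o).
Proof.
rewrite (le_trans (ler_norm _))// -(@lecR R) rnormE.
exact: normc_ge_Re.
Qed.

Lemma rnormN {R : realType} {V : normedModType R[i]} (v : V) :
  rnorm (- v) = rnorm v.
Proof. by rewrite /rnorm normrN. Qed.

Lemma rnormB {R : realType} {V : normedModType R[i]} (v w : V) :
  rnorm (v - w) = rnorm (w - v).
Proof. by rewrite -opprB rnormN. Qed.

Lemma rnormZR {R : realType} {V : normedModType R[i]} (a : R) (v : V) :
  0 <= a -> rnorm (a%:C *: v) = a * rnorm v.
Proof. by move=> a0; rewrite rnormZ ger0_norm// lecR. Qed.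

Lemma rnorm_gt0 {R : realType} {V : normedModType R[i]} (v : V) :
  v <> 0 -> 0 < rnorm v.
Proof.
move=> v0; rewrite lt_neqAle rnorm_ge0 andbT eq_sym.
by apply/eqP => /rnorm_eq0.
Qed.

Lemma lipschitz_rnormP {R : realType} {V W : normedModType R[i]} (f : V -> W) :
  lipschitz f <->
  exists2 M : R, 0 <= M & forall x y, rnorm (f x - f y) <= M * rnorm (x - y).
Proof.
split.
  move=> /pinfty_ex_gt0[M M0 fM]; exists (complex.Re M).
    by rewrite -(@lecR R) RRe_real ?gtr0_real// ltW.
  move=> x y; rewrite -(@lecR R) rmorphM/= !rnormE RRe_real ?gtr0_real//.
  by have := fM (x, y) (conj I I).
move=> [M M0 fM]; exists M%:C; split; first by rewrite complex_real.
move=> N MN [x y] _ /=; rewrite (le_trans _ (ler_wpM2r _ (ltW MN)))//.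
by rewrite -!rnormE -rmorphM lecR.
Qed.

Lemma continuous_linearP {R : realType} {V W : normedModType R[i]}
    (f : {linear V -> W}) :
  continuous f <-> exists2 M : R, 0 <= M & forall v, rnorm (f v) <= M * rnorm v.
Proof.
split.
  move=> /(_ 0)/continuous_linear_bounded/linear_boundedP[M [Mr fM]].
  have M1 : M < `|M| + 1.
    by rewrite (le_lt_trans (real_ler_norm Mr))// ltrDl.
  have e : (rnorm (M : R[i]^o) + 1)%:C = `|M| + 1 by rewrite rmorphD/= rnormE.
  exists (rnorm (M : R[i]^o) + 1); first by rewrite addr_ge0 ?rnorm_ge0.
  by move=> v; have := fM _ M1 v; rewrite -e -!rnormE -rmorphM lecR.
move=> [M M0 fM]; apply: bounded_linear_continuous; apply/linear_boundedP.
exists M%:C; split; first by rewrite complex_real.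
move=> N MN v; rewrite -rnormE (le_trans _ (ler_wpM2r _ (ltW MN)))//.
by rewrite -rnormE -rmorphM lecR.
Qed.

(** A real-linear [g] below [inf_translate rnorm x], rather than just below the norm, satisfies
    [g (- x) <= - rnorm x], hence attains the norm at [x]. Its complexification
    [v |-> g v - i g (i v)] is complex-linear with real part [g]. *)
Lemma norm_attaining_functional {R : realType} {V : normedModType R[i]}
    (x : V) :
  exists xs : {linear V -> R[i]^o},
    [/\ dual xs, forall v, rnorm (xs v) <= rnorm v & rnorm x <= rnorm (xs x)].
Proof.
have sn : sublinear (@rnorm R V).
  by split; [exact: ler_rnormD | move=> a v a0; rewrite rnormZR].
have [g [gq gD gZ]] := sublinear_minorant (inf_translate_sublinear x sn).
have g_le v : g v <= rnorm v.
  by rewrite (le_trans (gq v))// inf_translate_le_id.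
have gN v : g (- v) = - g v.
  by rewrite -scaleN1r -[-1]/(- (1%:C)) -rmorphN gZ mulN1r.
have gx : rnorm x <= g x.
  by rewrite -lerN2 -gN (le_trans (gq _))// inf_translateN.
pose xs (v : V) : R[i]^o := (g v +i* - g ('i *: v))%C.
have g_scale (a : R[i]) v :
    g (a *: v) = complex.Re a * g v + complex.Im a * g ('i *: v).
  rewrite [a in a *: _]complexE mulrC scalerDl gD -scalerA !gZ.
  by [].
have xs_linear : linear xs.
  move=> a v w; have gii : g ('i *: ('i *: v)) = - g v.
    by rewrite scalerA -expr2 sqr_i scaleN1r gN.
  have giav : 'i *: (a *: v) = a *: ('i *: v) by rewrite !scalerA mulrC.
  have Re_xs : g (a *: v + w) =
      complex.Re a * g v + complex.Im a * g ('i *: v) + g w.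
    by rewrite gD g_scale.
  have Im_xs : g ('i *: (a *: v + w)) =
      complex.Re a * g ('i *: v) - complex.Im a * g v + g ('i *: w).
    by rewrite scalerDr giav gD g_scale gii mulrN.
  transitivity (a * (g v +i* - g ('i *: v))%C + (g w +i* - g ('i *: w))%C);
    last by [].
  rewrite /xs Re_xs Im_xs {giav Re_xs Im_xs}.
  case: a => a b /=.
  move: (g v) (g w) (g ('i *: v)) (g ('i *: w)) => r1 r2 r3 r4.
  apply/eqP; rewrite eq_complex/=.
  apply/andP; split; apply/eqP.
    by ring.
  by ring.
pose xsl : {linear V -> R[i]^o} :=
  HB.pack xs (GRing.isLinear.Build R[i] V (R[i]^o) *:%R xs xs_linear).
have xs_le v : rnorm (xsl v) <= rnorm v.
  have [->|xv0] := eqVneq (xsl v) 0; first by rewrite rnorm0 rnorm_ge0.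
  (* Rotating [v] by the unimodular [th] makes the value of [xsl] real and nonnegative, hence equal
     to that of [g], which the norm dominates. *)
  pose th : R[i] := `|xsl v| / xsl v.
  have th1 : rnorm (th : R[i]^o) = 1.
    rewrite rnorm_complexE normrM normr_id normfV divff// normr_eq0//.
  have e : rnorm (xsl v) = g (th *: v).
    have : xsl (th *: v) = (rnorm (xsl v))%:C.
      rewrite linearZ/= rnormE /th -[_ *: _]/(_ * _) divfK//.
    by move=> /(congr1 (@complex.Re R)).
  rewrite e (le_trans (g_le _))// rnormZ.
  by rewrite -rnorm_complexE th1 mul1r.
exists xsl; split => //.
  apply/continuous_linearP; exists 1 => // v; rewrite mul1r; exact: xs_le.
by rewrite (le_trans gx)// (le_trans _ (ler_Re_rnorm (xsl x))).
Qed.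

(** * The modulus and square roots of complex numbers *)

Section complex_modulus.
Context {R : realType}.
Implicit Types (z w : R[i]).

Definition cabs z : R := rnorm (z : R[i]^o).

Lemma cabs_ge0 z : 0 <= cabs z.
Proof. exact: rnorm_ge0. Qed.

Lemma cabsM z w : cabs (z * w) = cabs z * cabs w.
Proof. exact: (rnormZ z (w : R[i]^o)). Qed.

Lemma cabs1 : cabs 1 = 1.
Proof. by rewrite /cabs rnorm_complexE normr1. Qed.

Lemma ler_cabsD z w : cabs (z + w) <= cabs z + cabs w.
Proof. exact: (@ler_rnormD _ (R[i]^o)). Qed.

Lemma cabsN z : cabs (- z) = cabs z.
Proof. exact: (@rnormN _ (R[i]^o)). Qed.

Lemma cabsR (a : R) : 0 <= a -> cabs a%:C = a.
Proof. by move=> a0; rewrite /cabs rnorm_complexE ger0_norm// lecR. Qed.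

Lemma cabs_half : cabs 2^-1 = 2^-1.
Proof.
have <- : (2^-1 : R)%:C = 2^-1 by rewrite fmorphV rmorph_nat.
by rewrite cabsR ?invr_ge0.
Qed.

Lemma sqr_cabs z : cabs z ^+ 2 = complex.Re z ^+ 2 + complex.Im z ^+ 2.
Proof.
apply: (@complexI R); rewrite add_Re2_Im2 rmorphXn/=.
congr (_ ^+ 2); exact: (@rnormE _ (R[i]^o) z).
Qed.

Lemma Re_sqrtc_ge0 z : 0 <= complex.Re (sqrtc z).
Proof. by case: z => a b; rewrite /sqrtc/=; exact: sqrtr_ge0. Qed.

(** With [q = sqrtc (1 - z)], one has [(1 - q) (1 + q) = z], and [1 + q] has modulus at least 1
    because [Re q >= 0]. *)
Lemma cabs_1Bsqrtc z : cabs z <= 1 -> cabs (1 - sqrtc (1 - z)) <= 1.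
Proof.
set q := sqrtc _ => z1.
have q2 : (1 - q) * (1 + q) = z.
  by rewrite -subr_sqr expr1n sqr_sqrtc opprB addrC subrK.
have q1 : 1 <= cabs (1 + q).
  rewrite (le_trans _ (ler_Re_rnorm _))// raddfD/= lerDl; exact: Re_sqrtc_ge0.
move: z1; rewrite -q2 cabsM; apply: le_trans.
by rewrite ler_peMr// cabs_ge0.
Qed.

(* Half-angle formula: a square root halves the defect [e] of
   [cos (arg p) >= 1 - e]. *)
Lemma Re_sqrt_ge (e : R) (p q : R[i]) : 0 <= e <= 1 -> q ^+ 2 = p ->
  0 <= complex.Re q -> (1 - e) * cabs p <= complex.Re p ->
  (1 - e / 2) * cabs q <= complex.Re q.
Proof.
move=> /andP[e0 e1] <- q0; rewrite expr2 cabsM -expr2 => h.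
have h2 := sqr_cabs q.
have hR : complex.Re (q * q) = complex.Re q ^+ 2 - complex.Im q ^+ 2.
  by case: (q) => a b /=; rewrite !expr2.
(* Adding [h] to [h2] gives [(1 - e / 2) |q|^2 <= (Re q)^2], and [(1 - e / 2)^2 <= 1 - e / 2]. *)
have k : ((1 - e / 2) * cabs q) ^+ 2 <= complex.Re q ^+ 2.
  rewrite exprMn; have := sqr_ge0 (cabs q).
  move: h; rewrite hR; move: h2; set x := cabs q ^+ 2; nra.
move: k; rewrite ler_pXn2r// nnegrE mulr_ge0 ?cabs_ge0//; lra.
Qed.

End complex_modulus.

(** * Uniform limits of bounded continuous functions *)

Section uniform_limits.
Context {R : realType} {Omega : topologicalType} {X : normedModType R[i]}.

Lemma continuous_rnormP (f : Omega -> X) : continuous f <->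
  forall t (e : R), 0 < e -> \forall s \near t, rnorm (f t - f s) <= e.
Proof.
split=> [cf t e e0|h t].
  have /cvgrPdist_le/(_ e%:C) := cf t.
  rewrite ltcR => /(_ e0); apply: filterS => s.
  by rewrite -rnormE lecR.
apply/cvgrPdist_le => e e0.
have ee : (complex.Re e)%:C = e by rewrite RRe_real// gtr0_real.
have := h t (complex.Re e); rewrite -(@ltcR R) ee => /(_ e0).
by apply: filterS => s; rewrite -(@lecR R) rnormE ee.
Qed.

(** Continuity and boundedness of [v] are derived from the approximation by an [e / 3] argument.
    This allows [v] to be built from the principal square root, whose continuity then need not be
    examined. *)
Lemma closed_uniform_limit (A : set (Cb Omega X)) (v : Omega -> X) : closed A ->
  (forall e : R, 0 < e -> exists2 g, A g & forall t, rnorm (v t - g t) <= e) ->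
  exists2 g, A g & forall t, g t = v t.
Proof.
move=> cA h.
have vP : v \in @Cb_pred R Omega X.
  apply/asboolP; split.
    apply/continuous_rnormP => t e e0.
    have [|g Ag vg] := h (e / 3); first by rewrite divr_gt0.
    have /continuous_rnormP/(_ t (e / 3)) := @Cb_continuous _ _ _ g.
    rewrite divr_gt0// => /(_ isT); apply: filterS => s gts.
    have -> : v t - v s = (v t - g t) + ((g t - g s) + (g s - v s)).
      by rewrite addrA subrKA subrKA.
    rewrite (le_trans (ler_rnormD _ _))//.
    have := ler_rnormD (g t - g s) (g s - v s).
    by have := vg t; have := vg s; rewrite rnormB; lra.
  have [//|g Ag vg] := h 1.
  apply/bounded_rnormP; exists (1 + supnorm g) => t.
  rewrite -[v t](subrK (g t)) (le_trans (ler_rnormD _ _))//.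
  exact: lerD (vg t) (supnorm_ub g t).
exists (MkCb vP) => //; apply: cA => B /nbhs_normP[e /= e0 eB].
have ee : (complex.Re e)%:C = e by rewrite RRe_real// gtr0_real.
have e0' : 0 < complex.Re e by rewrite -(@ltcR R) ee.
have [|g Ag vg] := h (complex.Re e / 2); first by rewrite divr_gt0.
exists g; split=> //; apply: eB => /=.
rewrite Cb_normE -ee ltcR (@le_lt_trans _ _ (complex.Re e / 2))//.
  by apply: supnorm_le => [|t]; [rewrite divr_ge0// ltW | exact: vg].
by rewrite ltr_pdivrMr// ltr_pMr// ltr1n.
Qed.

End uniform_limits.

(** * Peak functions with values in a Stolz region *)

Section function_algebra_peak.
Context {R : realType} {Omega : topologicalType}.
Context {A : set (Cb Omega R[i]^o)} (fA : function_algebra A).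

Lemma function_algebra_affine (a b : R[i]) f : A f ->
  exists2 g : Cb Omega R[i]^o, A g & forall t, g t = a * f t + b :> R[i].
Proof.
move=> Af; have [_ lin _ _ cst] := fA.
by exists (a *: f + Cb_cst (b : R[i]^o)) => //; exact: lin.
Qed.

Lemma function_algebra_half_sqr f v : A f -> A v ->
  exists2 g : Cb Omega R[i]^o, A g &
    forall t, g t = 2^-1 * (f t + v t ^+ 2) :> R[i].
Proof.
move=> Af Av; have [_ lin mul _ cst] := fA.
have A0 : A 0.
  have := lin (-1) f f Af Af; rewrite scaleN1r addNr//.
exists (2^-1 *: (1 *: f + Cb_mul v v) + 0) => [|t].
  by apply: (lin) => //; apply: (lin) => //; exact: mul.
have -> : (2^-1 *: (1 *: f + Cb_mul v v) + 0 : Cb Omega R[i]^o) t =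
  2^-1 * (1 * f t + v t * v t) + 0 by [].
by rewrite addr0 mul1r expr2.
Qed.

(** [1 - defect n] is the [n]-th iterate of [v |-> (1 + v^2) / 2] from 0, that is, the iteration for
    the square root in the extreme case [f = 1]. *)
Fixpoint defect n : R :=
  if n is m.+1 then defect m - defect m ^+ 2 / 2 else 1.

Lemma defect_bounds n : 0 <= defect n <= 2 / n.+2%:R.
Proof.
elim: n => [|n /andP[d0 d1]]; first by rewrite /= divff// lexx ler01.
have n2 : (0 : R) < n.+2%:R by rewrite ltr0n.
have n3 : (0 : R) < n.+3%:R by rewrite ltr0n.
have n32 : (n.+3%:R : R) = n.+2%:R + 1 by rewrite -natr1.
have d2 : 2 / n.+2%:R <= 1 :> R by rewrite ler_pdivrMr// mul1r ler_nat.
have dle1 := le_trans d1 d2.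
apply/andP; split=> /=; first by move: (defect n) d0 dle1 => x; nra.
(* The map [x |-> x - x^2 / 2] is increasing on [[0, 1]], so the inductive bound may be inserted. *)
have h : defect n - defect n ^+ 2 / 2 <= 2 / n.+2%:R - (2 / n.+2%:R) ^+ 2 / 2.
  by move: d1 d2; set x := 2 / _ => d1 d2; nra.
apply: (le_trans h); rewrite n32.
have -> : 2 / n.+2%:R - (2 / n.+2%:R) ^+ 2 / 2 =
  2 * (n.+2%:R - 1) / n.+2%:R ^+ 2 :> R by field; rewrite gt_eqF.
rewrite ler_pdivrMr ?exprn_gt0// mulrAC ler_pdivlMr -?n32//.
rewrite n32; nra.
Qed.

(* [1 - sqrt (1 - f)] is the fixed point of [v |-> (f + v^2) / 2], reached from
   [0] uniformly on the closed unit disc. *)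
Lemma function_algebra_sqrt f : A f -> (forall t, cabs (f t) <= 1) ->
  exists g : Cb Omega R[i]^o, [/\ A g,
    forall t, cabs (g t) <= 1,
    forall t, (1 - g t) ^+ 2 = 1 - f t :> R[i] &
    forall t, 0 <= complex.Re (1 - g t)].
Proof.
move=> Af f1; have [clA _ _ _ cst] := fA.
pose v t : R[i] := 1 - sqrtc (1 - f t).
have vE t : v t = 2^-1 * (f t + v t ^+ 2).
  have := sqr_sqrtc (1 - f t); rewrite /v; set q := sqrtc _ => q2.
  have -> : f t = 1 - q ^+ 2 by rewrite q2 subKr.
  by field.
have v1 t : cabs (v t) <= 1 by exact: cabs_1Bsqrtc.
(* The two bounds support each other: the new error is [(v - w) (v + w) / 2], and
   [|v + w| <= 2 - defect n], which reproduces the recursion of [defect]. *)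
have approx n : exists2 g : Cb Omega R[i]^o, A g &
    forall t, cabs (g t) <= 1 - defect n /\ cabs (v t - g t) <= defect n.
  elim: n => [|n [w Aw wP]].
    exists (Cb_cst (0 : R[i]^o)) => [|t]; first exact: cst.
    by rewrite /= subrr subr0; split=> //; rewrite /cabs rnorm0.
  have [g Ag gE] := function_algebra_half_sqr Af Aw; exists g => // t.
  have [w1 w2] := wP t; have d := defect_bounds n.
  have h2 := @cabs_half R.
  split.
    rewrite gE cabsM h2.
    have := ler_cabsD (f t) (w t ^+ 2); rewrite expr2 cabsM /=.
    by have := f1 t; have := cabs_ge0 (w t); nra.
  rewrite vE gE -mulrBr opprD addrACA subrr add0r subr_sqr !cabsM h2 /=.
  have := ler_cabsD (v t) (w t).
  have := v1 t; have := cabs_ge0 (v t - w t).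
  by have := cabs_ge0 (v t + w t); nra.
have [|g Ag gv] := closed_uniform_limit (X := R[i]^o) (v := v) clA.
  move=> e e0; pose n := Num.truncn (2 / e).
  have [g Ag gP] := approx n; exists g => // t.
  have [_ h] := gP t; rewrite (le_trans h)//.
  have /andP[_ d] := defect_bounds n; rewrite (le_trans d)//.
  rewrite ler_pdivrMr ?ltr0n// mulrC -ler_pdivrMr//.
  rewrite (le_trans (ltW (truncnS_gt (2 / e))))//.
  by rewrite ler_nat.
exists g; split=> // t; rewrite gv// /v subKr; first exact: sqr_sqrtc.
exact: Re_sqrtc_ge0.
Qed.

(* The functions [u] are the rescaled powers [(1 - f) ^ (1 / 2 ^ n)]. *)
Lemma function_algebra_thin_sector (f : Cb Omega R[i]^o) (t0 : Omega)
    (W : set Omega) (d eta : R) :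
  A f -> f t0 = 1 -> (forall t, cabs (f t) <= 1) ->
  d < 1 -> (forall t, W t -> cabs (f t) <= d) -> 0 < eta ->
  exists u : Cb Omega R[i]^o, [/\ A u, u t0 = 0,
    forall t, cabs (u t) <= 1,
    forall t, (1 - eta) * cabs (u t) <= complex.Re (u t) &
    forall t, W t -> 1 - eta <= cabs (u t)].
Proof.
move=> Af ft0 f1 d1 fd eta0.
pose M : R := (1 - d)^-1.
have M0 : 0 <= M by rewrite invr_ge0 subr_ge0 ltW.
(* Here [1 - g = (1 - f) ^ e]. Each square root halves the defect of the sector and the excess of
   the modulus over 1. The lower bound on [W] starts from [|1 - f| >= 1 - d = 1 / M] and persists
   since [(1 + e M / 2)^2 >= 1 + e M]. *)
have root n : exists g : Cb Omega R[i]^o, let e : R := (2 ^+ n)^-1 in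
  [/\ A g, g t0 = 1,
    forall t, cabs (g t) <= 1,
    forall t, (1 - e) * cabs (1 - g t) <= complex.Re (1 - g t) /\
              cabs (1 - g t) <= 1 + e &
    forall t, W t -> 1 <= cabs (1 - g t) * (1 + e * M)].
  elim: n => [|n [g]].
    exists f; rewrite /= expr0 invr1; split => //.
      move=> t; split.
        rewrite subrr mul0r raddfB/= subr_ge0.
        exact: le_trans (ler_Re_rnorm _) (f1 t).
      have := ler_cabsD 1 (- f t); rewrite cabsN cabs1.
      by move=> /le_trans; apply; rewrite lerD2l.
    move=> t Wt; have := ler_cabsD (1 - f t) (f t); rewrite subrK cabs1 => h.
    have h1 : 1 - d <= cabs (1 - f t) by have := fd t Wt; lra.
    have : (1 - d) * M = 1 by rewrite divff// gt_eqF// subr_gt0.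
    by rewrite mul1r; nra.
  set e : R := (2 ^+ n)^-1; move=> /= [Ag gt0 g1 gs gW].
  have e01 : 0 <= e <= 1.
    by rewrite invr_ge0 exprn_ge0//= invf_le1 ?exprn_gt0// exprn_ege1// ler1n.
  have eS : (2 ^+ n.+1)^-1 = e / 2 by rewrite exprS invfM mulrC.
  have [h [Ah h1 h2 hR]] := function_algebra_sqrt Ag g1.
  exists h; rewrite eS; split => //.
  - have := h2 t0; rewrite gt0 subrr => /eqP.
    by rewrite sqrf_eq0 subr_eq0 => /eqP.
  - move=> t; have [gs1 gs2] := gs t.
    split; first by apply: (Re_sqrt_ge e01 (h2 t)).
    move: gs2; rewrite -h2 expr2 cabsM.
    have := cabs_ge0 (1 - h t); move: e01 => /andP[]; nra.
  - move=> t Wt; have := gW t Wt; rewrite -h2 expr2 cabsM.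
    have := cabs_ge0 (1 - h t); move: e01 => /andP[].
    move: (cabs _) => x e0 e1 x0 hx.
    have eM : 0 <= e * M by rewrite mulr_ge0.
    have z0 : 0 <= x * (1 + e / 2 * M).
      by rewrite mulr_ge0// addr_ge0// mulrAC divr_ge0.
    rewrite -(expr_ge1 (n := 2))// (le_trans hx)//.
    have -> : (x * (1 + e / 2 * M)) ^+ 2 =
      x * x * (1 + e * M) + (x * (e * M) / 2) ^+ 2 by field.
    by rewrite lerDl sqr_ge0.
(* This makes [e <= eta] and, as [e <= 1], also [(1 + e) (1 + e M) <= 1 + eta]. *)
have [n ne] : exists n, (2 ^+ n)^-1 * (2 * M + 1 + eta) <= eta :> R.
  pose n := Num.truncn ((2 * M + 1 + eta) / eta); exists n.
  rewrite mulrC ler_pdivrMr ?exprn_gt0// [leRHS]mulrC -ler_pdivrMr//.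
  rewrite (le_trans (ltW (truncnS_gt _)))// -natrX ler_nat.
  exact: ltn_expl.
have [g] := root n; set e : R := (2 ^+ n)^-1; move=> /= [Ag gt0 g1 gs gW].
have e0 : 0 < e by rewrite invr_gt0 exprn_gt0.
have e1 : e <= 1 by rewrite invf_le1 ?exprn_gt0// exprn_ege1// ler1n.
have ee : e <= eta.
  have : 0 <= e * (2 * M + eta).
    apply: mulr_ge0; first exact: ltW.
    by apply: addr_ge0; [rewrite mulr_ge0 | exact: ltW].
  by move: ne; rewrite -/e; nra.
have k0 : 0 < 1 + e by lra.
(* Scaling [1 - g] by [k] brings its modulus below 1 and leaves the sector unchanged. *)
pose k : R := (1 + e)^-1.
have kk : k * (1 + e) = 1 by rewrite mulVf// gt_eqF.
have k_gt0 : 0 < k by rewrite invr_gt0.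
have [u Au uE'] := function_algebra_affine (- k%:C) k%:C Ag.
have uE t : u t = k%:C * (1 - g t) :> R[i].
  by rewrite uE' mulrBr mulr1 mulNr addrC.
have uabs t : cabs (u t) = k * cabs (1 - g t).
  by rewrite uE cabsM cabsR// ltW.
have uRe t : complex.Re (u t) = k * complex.Re (1 - g t).
  by rewrite uE; case: (1 - g t) => a b /=; rewrite mul0r subr0.
exists u; split => //.
- by rewrite uE gt0 subrr mulr0.
- by move=> t; rewrite uabs; have [_] := gs t; nra.
- move=> t; rewrite uabs uRe; have [h _] := gs t.
  rewrite mulrCA; apply: ler_wpM2l; first exact: ltW.
  by apply: le_trans h; rewrite ler_wpM2r ?cabs_ge0// lerD2l lerN2.
- move=> t Wt; rewrite uabs; have := gW t Wt.
  have eM : 0 <= e * M by rewrite mulr_ge0// ltW.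
  have eMe : e * M + e + e * M * e <= eta by move: ne; rewrite -/e; nra.
  have := cabs_ge0 (1 - g t); move: (cabs _) => x x0 h.
  have kx : 1 <= k * x * ((1 + e) * (1 + e * M)) by nra.
  have kx0 : 0 <= k * x by rewrite mulr_ge0// ltW.
  by move: kx kx0; move: (k * x) => y; nra.
Qed.

(** Take [phi = 1 - u], where [u] vanishes at [t0], lies in a thin sector around the positive axis
    and has modulus close to 1 off [U]. A thin enough sector maps into the Stolz region. *)
Lemma strong_peak_function (t0 : Omega) (U : set Omega) (eps : R) :
  strong_peak_points A t0 -> open U -> U t0 -> 0 < eps < 1 ->
  exists phi : Cb Omega R[i]^o, [/\ A phi, phi t0 = 1,
    forall t, cabs (phi t) + (1 - eps) * cabs (1 - phi t) <= 1,
    forall t, cabs (1 - phi t) <= 1 &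
    forall t, ~ U t -> cabs (phi t) <= eps].
Proof.
move=> [f [Af ft0 fU]] oU Ut0 /andP[e0 e1].
have fsup t : cabs (f t) <= rnorm f := supnorm_ub f t.
have f_gt0 : 0 < rnorm f.
  (* For [U] the whole space the supremum is over the empty set, with default value 0. *)
  by have := fU setT openT I; rewrite setCT image_set0 sup0.
have nz : f t0 != 0.
  by apply/eqP => f0; move: f_gt0; rewrite -ft0 f0 rnorm0 ltxx.
have [g Ag gE'] := function_algebra_affine (f t0)^-1 0 Af.
have gE t : g t = f t / f t0 :> R[i] by rewrite gE' addr0 mulrC.
have gabs t : cabs (g t) = cabs (f t) / rnorm f.
  rewrite gE cabsM; congr (_ * _); apply: (mulIf (lt0r_neq0 f_gt0)).
  rewrite mulVf ?gt_eqF// -[in X in _ * X]ft0 -/(cabs _) -cabsM mulVf//.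
  exact: cabs1.
pose s := sup [set rnorm (f t) | t in ~` U].
have [|||||u [Au u0 u1 uR uU]] := @function_algebra_thin_sector g t0 (~` U)
    (s / rnorm f) (eps ^+ 2 / 4) Ag.
- by rewrite gE divff.
- by move=> t; rewrite gabs ler_pdivrMr// mul1r.
- by rewrite ltr_pdivrMr// mul1r; exact: fU.
- move=> t Ut; rewrite gabs ler_pM2r ?invr_gt0//.
  apply: ub_le_sup; last by exists t.
  by exists (rnorm f) => _ [r _ <-]; exact: fsup.
- by rewrite divr_gt0// exprn_gt0.
have [phi Aphi phiE'] := function_algebra_affine (-1) 1 Au.
have phiE t : phi t = 1 - u t :> R[i] by rewrite phiE' mulN1r addrC.
have phiK t : 1 - phi t = u t :> R[i] by rewrite phiE subKr.
(* Expand [|1 - u|^2 = 1 - 2 Re u + |u|^2] and use [Re u >= (1 - eps^2 / 4) |u|]. *)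
have phiS t :
    cabs (phi t) ^+ 2 <= (1 - cabs (u t)) ^+ 2 + eps ^+ 2 / 2 * cabs (u t).
  rewrite sqr_cabs phiE; have := sqr_cabs (u t); have := uR t.
  case: (u t) => a b /=; nra.
have le_pow (x y : R) : 0 <= y -> x ^+ 2 <= y ^+ 2 -> x <= y.
  by move=> y0 h; rewrite leNgt; apply/negP => yx; nra.
exists phi; split => //.
- by rewrite phiE u0 subr0.
- move=> t; rewrite phiK -lerBrDr; apply: le_pow.
    by have := u1 t; have := cabs_ge0 (u t); nra.
  apply: (le_trans (phiS t)); have := u1 t; have := cabs_ge0 (u t).
  move: (cabs _) => x x0 x1; rewrite -subr_ge0.
  have -> : (1 - (1 - eps) * x) ^+ 2 - ((1 - x) ^+ 2 + eps ^+ 2 / 2 * x) =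
    x * ((1 - x) * (eps * (2 - eps)) + eps ^+ 2 / 2) by field.
  apply: mulr_ge0 => //; apply: addr_ge0.
    by apply: mulr_ge0; [lra | apply: mulr_ge0; lra].
  by rewrite divr_ge0// sqr_ge0.
- by move=> t; rewrite phiK.
- move=> t Ut; apply: le_pow; first exact: ltW.
  apply: (le_trans (phiS t)); have := u1 t; have := uU t Ut.
  move: (cabs _) => x x0 x1; nra.
Qed.

End function_algebra_peak.

(** * The Lipschitz numerical index *)

Section numerical_index.
Context {R : realType}.
Implicit Types (Z X : normedModType R[i]).

(** The sign of [M] covers the empty set, where [sup] is 0. *)
Lemma sup_le_ge0 (E : set R) (M : R) :
  0 <= M -> (forall x, E x -> x <= M) -> sup E <= M.
Proof.
move=> M0 h; have [->|/set0P E0] := eqVneq E set0; first by rewrite sup0.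
exact: ge_sup.
Qed.

Lemma sup_ge_ge0 (E : set R) : (forall x, E x -> 0 <= x) -> 0 <= sup E.
Proof.
move=> h; have [[[x Ex] uE]|/sup_out->//] := pselect (has_sup E).
exact: le_trans (h x Ex) (ub_le_sup uE Ex).
Qed.

Lemma dual_norm_le Z (zs : {linear Z -> R[i]^o}) (M : R) : 0 <= M ->
  (forall z, rnorm (zs z) <= M * rnorm z) -> dual_norm zs <= M.
Proof.
move=> M0 h; apply: sup_le_ge0 => // _ [z /= z1 <-].
by rewrite (le_trans (h z))// ler_piMr.
Qed.

Lemma le_dual_norm Z (zs : {linear Z -> R[i]^o}) z :
  dual zs -> rnorm (zs z) <= dual_norm zs * rnorm z.
Proof.
move=> /continuous_linearP[M M0 zsM].
have [->|/eqP/rnorm_gt0 z0] := eqVneq z 0.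
  by rewrite linear0 !rnorm0 mulr0.
rewrite -ler_pdivrMr// mulrC -rnormZR ?invr_ge0 ?rnorm_ge0// -linearZ/=.
apply: ub_le_sup.
  exists M => _ [w /= w1 <-].
  by rewrite (le_trans (zsM w))// ler_piMr.
exists ((rnorm z)^-1%:C *: z) => //=.
by rewrite rnormZR ?invr_ge0 ?rnorm_ge0// mulVf// gt_eqF.
Qed.

Lemma dual_norm_D Z z (zs : {linear Z -> R[i]^o}) :
  z <> 0 -> D z zs -> dual_norm zs = rnorm z.
Proof.
move=> /rnorm_gt0 z0 [_ _]; rewrite expr2; apply: mulIf.
by rewrite gt_eqF.
Qed.

Lemma lip_norm_has_ubound Z (T : Z -> Z) : Lip0 T -> has_ubound
  [set r | exists x y : Z, x <> y /\ r = rnorm (T x - T y) / rnorm (x - y)].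
Proof.
move=> [/lipschitz_rnormP[M M0 TM] _]; exists M => _ [x [y [xy ->]]].
have /rnorm_gt0 d0 : x - y <> 0 by move/subr0_eq.
by rewrite ler_pdivrMr.
Qed.

Lemma le_lip_norm Z (T : Z -> Z) x y : Lip0 T ->
  rnorm (T x - T y) <= lip_norm T * rnorm (x - y).
Proof.
move=> LT; have [->|/eqP xy] := eqVneq x y.
  by rewrite !subrr !rnorm0 mulr0.
have /rnorm_gt0 d0 : x - y <> 0 by move/subr0_eq.
rewrite -ler_pdivrMr//; apply: ub_le_sup; first exact: lip_norm_has_ubound.
by exists x, y.
Qed.

Lemma nuL_ge0 Z (T : Z -> Z) : 0 <= nuL T.
Proof.
apply: sup_ge_ge0 => _ [x [y [zs [_ _ ->]]]].
by rewrite divr_ge0 ?rnorm_ge0 ?exprn_ge0 ?rnorm_ge0.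
Qed.

Lemma nuL_has_ubound Z (T : Z -> Z) : Lip0 T ->
  has_ubound [set r | exists (x y : Z) (zs : {linear Z -> R[i]^o}),
    [/\ x <> y, D (x - y) zs
      & r = rnorm (zs (T x - T y)) / rnorm (x - y) ^+ 2]].
Proof.
move=> LT; exists (lip_norm T) => _ [x [y [zs [xy Dzs ->]]]].
have d0 : x - y <> 0 by move/subr0_eq.
rewrite ler_pdivrMr ?exprn_gt0 ?rnorm_gt0//.
rewrite (le_trans (le_dual_norm _ _))//; first by case: Dzs.
rewrite (dual_norm_D d0 Dzs) expr2 mulrCA ler_wpM2l ?rnorm_ge0//.
exact: le_lip_norm.
Qed.

Lemma le_nuL Z (T : Z -> Z) x y (zs : {linear Z -> R[i]^o}) :
  Lip0 T -> x <> y -> D (x - y) zs ->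
  rnorm (zs (T x - T y)) <= nuL T * rnorm (x - y) ^+ 2.
Proof.
move=> LT xy Dzs; have /rnorm_gt0 d0 : x - y <> 0 by move/subr0_eq.
rewrite -ler_pdivrMr ?exprn_gt0//; apply: ub_le_sup; last by exists x, y, zs.
exact: nuL_has_ubound.
Qed.

(** Dividing [S] by its Lipschitz norm gives a competitor in the infimum, and the numerical radius
    scales by the same factor. *)
Lemma nL_le Z (S : Z -> Z) : Lip0 S -> 0 < lip_norm S ->
  (nL Z <= (nuL S / lip_norm S)%:E)%E.
Proof.
move=> LS l0; set l := lip_norm S in l0 *.
have li0 : 0 <= l^-1 by rewrite invr_ge0 ltW.
pose S' z := l^-1%:C *: S z.
have S'B x y : S' x - S' y = l^-1%:C *: (S x - S y) by rewrite scalerBr.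
have LS' : Lip0 S'.
  split; last by rewrite /S'; case: LS => _ ->; rewrite scaler0.
  apply/lipschitz_rnormP; exists (l^-1 * l) => [|x y].
    by rewrite mulr_ge0// ltW.
  by rewrite S'B rnormZR// -mulrA ler_wpM2l//; exact: le_lip_norm.
have lS' : lip_norm S' = 1.
  apply/eqP; rewrite eq_le; apply/andP; split.
    apply: sup_le_ge0 => // _ [x [y [xy ->]]].
    have /rnorm_gt0 d0 : x - y <> 0 by move/subr0_eq.
    rewrite ler_pdivrMr// S'B rnormZR// mul1r ler_pdivrMl//.
    exact: le_lip_norm.
  rewrite -(ler_pM2r l0) mul1r; apply: sup_le_ge0.
    apply: mulr_ge0; last exact: ltW.
    apply: sup_ge_ge0 => _ [x [y [_ ->]]].
    by rewrite divr_ge0// rnorm_ge0.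
  move=> _ [x [y [xy ->]]].
  have /rnorm_gt0 d0 : x - y <> 0 by move/subr0_eq.
  rewrite ler_pdivrMr// mulrAC -ler_pdivrMr//.
  by have := le_lip_norm x y LS'; rewrite S'B rnormZR// mulrC.
apply: (@le_trans _ _ (nuL S')%:E); first by apply: ereal_inf_lbound; exists S'.
rewrite lee_fin; apply: sup_le_ge0; first by rewrite mulr_ge0// nuL_ge0.
move=> _ [x [y [zs [xy Dzs ->]]]].
have /rnorm_gt0 d0 : x - y <> 0 by move/subr0_eq.
rewrite ler_pdivrMr ?exprn_gt0// S'B linearZ/= rnormZR//.
by rewrite [leRHS]mulrAC [leLHS]mulrC ler_wpM2r//; exact: le_nuL.
Qed.

(* [S x = ev (T (a + Psi x)) - ev (T a)]: as [Psi] is an isometric section of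
   the contraction [ev], composing with [ev] maps [D (x - y)] into
   [D (Psi x - Psi y)], whence [nuL S <= nuL T]. *)
Lemma nL_le_section X Z (ev : {linear Z -> X}) (Psi : X -> Z)
    (T : Z -> Z) (a : Z) (p : X) (L : R) :
  (forall z, rnorm (ev z) <= rnorm z) ->
  (forall x y, rnorm (Psi x - Psi y) <= rnorm (x - y)) ->
  cancel Psi ev -> Psi 0 = 0 -> Lip0 T -> 0 < L ->
  L * rnorm p < rnorm (ev (T (a + Psi p)) - ev (T a)) ->
  (nL X <= (nuL T / L)%:E)%E.
Proof.
move=> ev1 Psi1 PsiK Psi0 LT L0 Lp.
pose S x := ev (T (a + Psi x)) - ev (T a).
have SB x y : S x - S y = ev (T (a + Psi x) - T (a + Psi y)).
  by rewrite (linearB ev) /S opprB addrA subrK.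
have aPsiB x y : a + Psi x - (a + Psi y) = Psi x - Psi y.
  by rewrite opprD addrACA subrr add0r.
have evPsiB x y : ev (Psi x - Psi y) = x - y by rewrite (linearB ev)/= !PsiK.
have rPsiB x y : rnorm (Psi x - Psi y) = rnorm (x - y).
  by apply/eqP; rewrite eq_le Psi1/= -[in leLHS]evPsiB ev1.
have LS : Lip0 S.
  split; last by rewrite /S Psi0 addr0 subrr.
  apply/lipschitz_rnormP; exists (lip_norm T) => [|x y].
    by apply: sup_ge_ge0 => _ [x [y [_ ->]]]; rewrite divr_ge0 ?rnorm_ge0.
  rewrite SB (le_trans (ev1 _))// -rPsiB -aPsiB; exact: le_lip_norm.
have p0 : 0 < rnorm p.
  apply: rnorm_gt0 => p0; move: Lp; rewrite p0 Psi0 addr0 subrr.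
  by rewrite !rnorm0 mulr0 ltxx.
(* The pair [p], [0] already witnesses a quotient above [L]. *)
have lS : L < lip_norm S.
  rewrite -(ltr_pM2r p0) (lt_le_trans Lp)//.
  by have := le_lip_norm p 0 LS; rewrite (proj2 LS) !subr0.
have l0 : 0 < lip_norm S by exact: lt_trans lS.
apply: (le_trans (nL_le LS l0)); rewrite lee_fin.
have nuST : nuL S <= nuL T.
  apply: sup_le_ge0; first exact: nuL_ge0.
  move=> _ [x [y [xs [xy Dxs ->]]]].
  have xy0 : x - y <> 0 by move/subr0_eq.
  have d0 := rnorm_gt0 xy0.
  rewrite ler_pdivrMr ?exprn_gt0// SB.
  have nxs := dual_norm_D xy0 Dxs; have [dxs xsE _] := Dxs.
  pose zs : {linear Z -> R[i]^o} := xs \o ev.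
  have zsE z : zs z = xs (ev z) by [].
  have zs_le z : rnorm (zs z) <= rnorm (x - y) * rnorm z.
    rewrite zsE (le_trans (le_dual_norm _ dxs))// nxs ler_wpM2l ?rnorm_ge0//.
  have dzs : dual zs.
    by apply/continuous_linearP; exists (rnorm (x - y)) => //; exact: rnorm_ge0.
  have zsPsi : zs (Psi x - Psi y) = (rnorm (x - y) ^+ 2)%:C.
    by rewrite zsE evPsiB xsE nxs expr2.
  (* The norm of [zs] is attained at [Psi x - Psi y], which has the same norm as [x - y]. *)
  have nzs : dual_norm zs = rnorm (x - y).
    apply/eqP; rewrite eq_le dual_norm_le ?rnorm_ge0//=.
    rewrite -(ler_pM2r d0) -expr2 -[in leRHS]rPsiB.
    apply: le_trans (le_dual_norm _ dzs); rewrite zsPsi.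
    exact: (ler_Re_rnorm (rnorm (x - y) ^+ 2)%:C).
  have Dzs : D (a + Psi x - (a + Psi y)) zs.
    by rewrite aPsiB; split=> //; rewrite nzs rPsiB -?expr2.
  have axy : a + Psi x <> a + Psi y.
    by move=> /addrI/(congr1 ev); rewrite !PsiK.
  by have := le_nuL LT axy Dzs; rewrite aPsiB rPsiB zsE.
apply: ler_pM => //; [exact: nuL_ge0 | by rewrite invr_ge0 ltW|].
by rewrite lef_pV2 ?posrE// ltW.
Qed.

(** Opposite multiples of a unit vector [y] in the direction of [x], with coefficients
    [(r + |x|) / 2] and [- (r - |x|) / 2]. The vector [w] supplies a direction when [x = 0]. *)
Lemma sum_two_vectors X (w x : X) (r : R) : w <> 0 -> rnorm x <= r ->
  exists p q : X, p + q = x /\ rnorm p + rnorm q = r.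
Proof.
move=> w0 xr.
have [y y1 xE] : exists2 y : X, rnorm y = 1 & x = (rnorm x)%:C *: y.
  have unit (v : X) : v <> 0 -> rnorm ((rnorm v)^-1%:C *: v) = 1.
    move=> /rnorm_gt0 v0; rewrite rnormZR ?invr_ge0 ?rnorm_ge0// mulVf//.
    by rewrite gt_eqF.
  have [x0|/eqP x0] := eqVneq x 0.
    by exists ((rnorm w)^-1%:C *: w); [exact: unit | rewrite x0 rnorm0 scale0r].
  exists ((rnorm x)^-1%:C *: x); first exact: unit.
  by rewrite scalerA -rmorphM mulfV ?scale1r// gt_eqF// rnorm_gt0.
have x0 := rnorm_ge0 x.
exists (((r + rnorm x) / 2)%:C *: y), (- (((r - rnorm x) / 2)%:C *: y)); split.
  by rewrite -scalerBl -rmorphB [RHS]xE; congr (_%:C *: _); field.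
by rewrite rnormN !rnormZR ?y1; [field | lra | lra].
Qed.

End numerical_index.

(** * Spaces of vector-valued functions *)

Section vector_valued.
Context {R : realType} {Omega : topologicalType} {X : normedModType R[i]}.
Context (AOX : submodClosed (Cb Omega X)).
Let Z := sub_normed AOX.
Let A := base_algebra [set f | f \in AOX].

Definition eval_at (t : Omega) (z : Z) : X := val z t.

Lemma eval_at_linear t : linear (eval_at t).
Proof. by move=> a v w; rewrite /eval_at linearP. Qed.

HB.instance Definition _ t :=
  GRing.isLinear.Build R[i] Z X *:%R (eval_at t) (eval_at_linear t).

Lemma rnorm_eval_at t (z : Z) : rnorm (eval_at t z) <= rnorm z.
Proof. exact: supnorm_ub. Qed.

Lemma rnorm_eval_le (z : Z) (M : R) : 0 <= M ->
  (forall t, rnorm (eval_at t z) <= M) -> rnorm z <= M.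
Proof. exact: supnorm_le. Qed.

(** Pick [t] where [z] exceeds [M] in norm and a contractive functional [xs] attaining the norm of
    [z t]. Then [xs \o z] belongs to [A] and exceeds [M] somewhere on [G], where [z] does so too. *)
Lemma norming_eval_at (G : set Omega) (z : Z) (M : R) :
  norming A G -> 0 <= M < rnorm z ->
  exists2 t0, G t0 & M < rnorm (eval_at t0 z).
Proof.
move=> normG /andP[M0 Mz].
have [t Mt] : exists t, M < rnorm (eval_at t z).
  apply: contrapT => /forallNP h; move: Mz; apply/negP; rewrite -leNgt.
  by apply: rnorm_eval_le => // t; rewrite leNgt; apply/negP.
have [xs [dxs xs1 xst]] := norm_attaining_functional (eval_at t z).
have phiP : (fun t => xs (eval_at t z)) \in @Cb_pred R Omega R[i]^o.
  apply/asboolP; split.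
    apply/continuous_rnormP => s e e0.
    have /continuous_rnormP/(_ s e e0) := @Cb_continuous _ _ _ (val z).
    apply: filterS => r; apply: le_trans.
    by rewrite -(linearB xs); exact: xs1.
  apply/bounded_rnormP; exists (rnorm z) => s.
  by rewrite (le_trans (xs1 _))// rnorm_eval_at.
pose phi : Cb Omega R[i]^o := MkCb phiP.
have Aphi : A phi by exists (val z), xs; split=> //; exact: valP.
have supphi : M < sup [set rnorm (phi t) | t in G].
  rewrite -normG//; apply: lt_le_trans Mt _; apply: le_trans xst _.
  exact: (supnorm_ub phi t).
apply: contrapT => h; move: supphi; apply/negP; rewrite -leNgt.
apply: sup_le_ge0 => // _ [s Gs <-]; rewrite leNgt; apply/negP => Ms.
by apply: h; exists s => //; exact: lt_le_trans Ms (xs1 _).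
Qed.

(** The norm is 1-Lipschitz and [k t] has norm at most that of [k], so at each [t] the map [Psi] is
    Lipschitz with constant [|phi t| + (1 - eps) |1 - phi t|], at most 1 by the Stolz condition. *)
Lemma peak_section (t0 : Omega) (phi : Cb Omega R[i]^o) (k : Z) (eps : R) :
  A_space [set f | f \in AOX] -> 0 < rnorm k -> 0 < eps < 1 ->
  A phi -> phi t0 = 1 ->
  (forall t, cabs (phi t) + (1 - eps) * cabs (1 - phi t) <= 1) ->
  exists Psi : X -> Z, [/\ cancel Psi (eval_at t0), Psi 0 = 0,
    forall x y, rnorm (Psi x - Psi y) <= rnorm (x - y) &
    forall x t, eval_at t (Psi x) =
      phi t *: x +
      ((1 - eps) * (rnorm x / rnorm k))%:C *: ((1 - phi t) *: eval_at t k)].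
Proof.
move=> [_ fA tensor mul] k0 /andP[e0 e1] Aphi phit0 stolz.
have [psi Apsi psiE'] := function_algebra_affine fA (-1) 1 Aphi.
have psiE t : psi t = 1 - phi t :> R[i] by rewrite psiE' mulN1r addrC.
have PsiP x : exists z : Z, forall t, eval_at t z =
    phi t *: x +
      ((1 - eps) * (rnorm x / rnorm k))%:C *: ((1 - phi t) *: eval_at t k).
  pose b := ((1 - eps) * (rnorm x / rnorm k))%:C.
  have S1 : Cb_mul phi (Cb_cst x) \in AOX by exact: tensor.
  have S2 : Cb_mul psi (val k) \in AOX by apply: mul => //; exact: valP.
  have S3 : Cb_mul phi (Cb_cst x) + b *: Cb_mul psi (val k) \in AOX.
    by rewrite rpredD// rpredZ.
  by exists (SubNormed S3) => t; rewrite -psiE.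
have [Psi PsiE] := choice PsiP.
exists Psi; split => //.
- by move=> x; rewrite PsiE phit0 subrr scale0r scaler0 addr0 scale1r.
- apply: rnorm_eq0; apply/eqP; rewrite eq_le rnorm_ge0 andbT.
  apply: rnorm_eval_le => // t.
  by rewrite PsiE rnorm0 mul0r mulr0 scale0r scaler0 addr0 rnorm0.
- move=> x y; apply: rnorm_eval_le => [|t]; first exact: rnorm_ge0.
  rewrite linearB/= !PsiE opprD addrACA -scalerBr -scalerBl -rmorphB/=.
  rewrite -mulrBr -mulrBl (le_trans (ler_rnormD _ _))// !rnormZ.
  rewrite -!/(rnorm (_ : R[i]^o)) -!/(cabs _).
  set c := cabs _%:C.
  have cE : c = (1 - eps) * (`|rnorm x - rnorm y| / rnorm k).
    rewrite /c rmorphM cabsM cabsR ?subr_ge0 ?ltW//; congr (_ * _).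
    rewrite /cabs rnorm_complexE normc_def/= expr0n/= addr0 sqrtr_sqr.
    by rewrite normrM normfV [in X in _ / X]ger0_norm// ltW.
  have xy : `|rnorm x - rnorm y| <= rnorm (x - y).
    have := ler_rnormD (x - y) y; have := ler_rnormD (y - x) x.
    rewrite !subrK [rnorm (y - x)]rnormB ler_norml; lra.
  have kt : rnorm (eval_at t k) / rnorm k <= 1.
    by rewrite ler_pdivrMr// mul1r rnorm_eval_at.
  have kt0 : 0 <= rnorm (eval_at t k) / rnorm k.
    by rewrite divr_ge0 ?rnorm_ge0// ltW.
  have -> : c * (cabs (1 - phi t) * rnorm (eval_at t k)) =
    (1 - eps) * cabs (1 - phi t) *
    (`|rnorm x - rnorm y| * (rnorm (eval_at t k) / rnorm k)).
    by rewrite cE; ring.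
  have h : `|rnorm x - rnorm y| * (rnorm (eval_at t k) / rnorm k) <=
      rnorm (x - y).
    by rewrite (le_trans _ xy)// ler_piMr.
  have q0 : 0 <= (1 - eps) * cabs (1 - phi t).
    by rewrite mulr_ge0 ?cabs_ge0// subr_ge0 ltW.
  apply: (le_trans (lerD (lexx _) (ler_wpM2l q0 h))).
  by rewrite -mulrDl ler_piMl ?rnorm_ge0.
Qed.

Lemma nL_le_approx (T : Z -> Z) (eps : R) :
  A_space [set f | f \in AOX] -> norming A (strong_peak_points A) ->
  Lip0 T -> lip_norm T = 1 -> 0 < eps -> 4 * eps < 1 ->
  (nL X <= (nuL T / (1 - 4 * eps))%:E)%E.
Proof.
move=> AOXP normA LT lT e0 e4.
have [_ fA _ _] := AOXP.
(* Without a genuine supremum [lip_norm T] would take the default value 0 instead of 1. *)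
have supT : has_sup
    [set r | exists x y : Z, x <> y /\ r = rnorm (T x - T y) / rnorm (x - y)].
  apply: contrapT => /sup_out h; have := @oner_neq0 R.
  by rewrite -lT /lip_norm h eqxx.
have [_ [f [g [fg ->]]]] := sup_adherent e0 supT.
rewrite -/(lip_norm T) lT.
have k0 : 0 < rnorm (f - g) by apply: rnorm_gt0; move/subr0_eq.
have [k kE] : {k | k = f - g} by exists (f - g).
rewrite -kE in k0 *; set r := rnorm k in k0 *.
rewrite ltr_pdivlMr// => Tfg.
have e10 : 0 <= 1 - eps by lra.
have [|t0 rho0 Tt0] := @norming_eval_at _ (T f - T g) ((1 - eps) * r) normA.
  by rewrite Tfg mulr_ge0// ltW.
(* [sum_two_vectors] needs a nonzero vector of [X], since [k] may vanish at [t0]. *)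
have w0 : eval_at t0 (T f - T g) <> 0.
  by move=> w; move: Tt0; rewrite w rnorm0 ltNge mulr_ge0// ltW.
pose U := [set s | rnorm (eval_at t0 k - eval_at s k) <= eps * r]^°.
have oU : open U := open_interior _.
have Ut0 : U t0.
  have /continuous_rnormP := @Cb_continuous _ _ _ (val k).
  by move/(_ t0 (eps * r) (mulr_gt0 e0 k0)).
have Uk s : U s -> rnorm (eval_at t0 k - eval_at s k) <= eps * r.
  exact: interior_subset.
have [|phi [Aphi phit0 stolz phi1 phiU]] :=
  strong_peak_function (eps := eps) fA rho0 oU Ut0.
  by rewrite e0; lra.
have [|Psi [PsiK Psi0 Psi1 PsiE]] :=
  @peak_section t0 phi k eps AOXP k0 _ Aphi phit0 stolz.
  by rewrite e0; lra.
have [p [q [pq pqr]]] := sum_two_vectors w0 (rnorm_eval_at t0 k).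
(* As [p + q = k t0] and the norms of [p] and [q] add up to [r], the error at [t] is
   [eps (1 - phi t) k t - phi t (k t0 - k t)]. The first term costs [eps r]. The second costs at
   most [2 eps r]: on [U] the oscillation of [k] is small, off [U] it is [phi]. *)
have close : rnorm (f - (g + Psi p + Psi q)) <= 3 * eps * r.
  apply: rnorm_eval_le => [|t]; first by rewrite !mulr_ge0// ltW.
  have -> : f - (g + Psi p + Psi q) = k - (Psi p + Psi q).
    by rewrite kE -addrA opprD addrA.
  rewrite (linearB (eval_at t)) (linearD (eval_at t))/= !PsiE.
  rewrite addrACA -scalerDr -scalerDl -rmorphD/= -mulrDr.
  rewrite -mulrDl pqr divff ?gt_eqF// mulr1 pq.
  have -> : eval_at t k - (phi t *: eval_at t0 k +
      (1 - eps)%:C *: ((1 - phi t) *: eval_at t k)) =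
    - (phi t *: (eval_at t0 k - eval_at t k)) +
      eps%:C *: ((1 - phi t) *: eval_at t k).
    rewrite rmorphB rmorph1 [(1 - _) *: (_ *: _)]scalerBl scale1r scalerBr.
    rewrite !opprD !opprK !addrA; congr (_ + _).
    rewrite scalerBl scale1r opprB [eval_at t k - _]addrC.
    by rewrite [phi t *: eval_at t k - _]addrC addrA addrK.
  rewrite (le_trans (ler_rnormD _ _))// rnormN (rnormZR _ (ltW e0)) !rnormZ.
  rewrite -!/(rnorm (_ : R[i]^o)) -!/(cabs _).
  have kt : rnorm (eval_at t k) <= r := rnorm_eval_at t k.
  have kt0 : rnorm (eval_at t0 k) <= r := rnorm_eval_at t0 k.
  have d2 : rnorm (eval_at t0 k - eval_at t k) <= 2 * r.
    have := ler_rnormD (eval_at t0 k) (- eval_at t k); rewrite rnormN; lra.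
  have b : cabs (1 - phi t) * rnorm (eval_at t k) <= r.
    have := phi1 t; have := cabs_ge0 (1 - phi t).
    have := rnorm_ge0 (eval_at t k); nra.
  have a : cabs (phi t) * rnorm (eval_at t0 k - eval_at t k) <= 2 * (eps * r).
    have d0 := rnorm_ge0 (eval_at t0 k - eval_at t k).
    have c0 := cabs_ge0 (phi t); have er : 0 < eps * r by rewrite mulr_gt0.
    have [Ut|nUt] := pselect (U t).
      have d1 := Uk t Ut.
      have c1 : cabs (phi t) <= 1.
        have := stolz t; have := cabs_ge0 (1 - phi t); nra.
      by have := ler_pM c0 d0 c1 d1; lra.
    by have := ler_pM c0 d0 (phiU t nUt) d2; lra.
  by have := ler_wpM2l (ltW e0) b; lra.
have e41 : 0 < 1 - 4 * eps by lra.
have Tclose : rnorm (T f - T (g + Psi p + Psi q)) <= 3 * eps * r.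
  have := le_lip_norm f (g + Psi p + Psi q) LT.
  by rewrite lT mul1r => /le_trans; exact.
(* Of the [4 eps], one comes from the choice of [f], [g] and [t0], and three from [close], since [T]
   and the evaluation do not increase distances. *)
have total : (1 - 4 * eps) * (rnorm p + rnorm q) <
    rnorm (eval_at t0 (T (g + Psi p + Psi q)) - eval_at t0 (T (g + Psi p))) +
    rnorm (eval_at t0 (T (g + Psi p)) - eval_at t0 (T g)).
  rewrite pqr.
  apply: lt_le_trans (ler_rnormD _ _).
  rewrite addrA subrK -(linearB (eval_at t0))/=.
  have -> : (1 - 4 * eps) * r = (1 - eps) * r - 3 * eps * r by ring.
  rewrite ltrBlDr (lt_le_trans Tt0)// -(subrK (T (g + Psi p + Psi q)) (T f)).
  rewrite -addrA (linearD (eval_at t0))/= (le_trans (ler_rnormD _ _))//.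
  rewrite [leRHS]addrC lerD2r; exact: le_trans (rnorm_eval_at _ _) Tclose.
(* By [total], at least one of the two steps must exceed its own share of the sum. *)
have [hp|hp] := ltP ((1 - 4 * eps) * rnorm p)
    (rnorm (eval_at t0 (T (g + Psi p)) - eval_at t0 (T g))).
  exact: (nL_le_section (rnorm_eval_at t0) Psi1 PsiK Psi0 LT e41 hp).
apply: (nL_le_section (rnorm_eval_at t0) Psi1 PsiK Psi0 LT e41
  (a := g + Psi p) (p := q)).
rewrite -(ltrD2r ((1 - 4 * eps) * rnorm p)) -mulrDr [rnorm q + _]addrC.
exact: lt_le_trans total (lerD (lexx _) hp).
Qed.

End vector_valued.

Theorem theorem3p5 (R : realType) (Omega : topologicalType)
    (Omega_hausdorff : hausdorff_space Omega)
    (X : completeNormedModType R[i])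
    (AOX : submodClosed (Cb Omega X))
    (AOX_space : A_space [set f | f \in AOX])
    (rho_norming : norming (base_algebra [set f | f \in AOX])
       (strong_peak_points (base_algebra [set f | f \in AOX]))) :
  (nL X <= nL (sub_normed AOX))%E.
Proof.
apply: le_ereal_inf_tmp => _ [T [LT lT] <-].
apply/lee_addgt0Pr => e e0.
have N0 := nuL_ge0 T; set N := nuL T in N0 *.
(* The goal is [N <= (N + e) (1 - 4 eps)]: the second entry gives [4 eps N <= e / 2], the first
   [4 eps e <= e / 2]. *)
pose eps := Num.min (1 / 8) (e / (8 * (N + 1))).
have eps8 : eps <= 1 / 8 by rewrite ge_min lexx.
have epsN : eps * (8 * (N + 1)) <= e.
  by rewrite -ler_pdivlMr; [rewrite ge_min lexx orbT | lra].
have eps0 : 0 < eps.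
  by rewrite lt_min; apply/andP; split; apply: divr_gt0; lra.
have e41 : 0 < 1 - 4 * eps by lra.
apply: (le_trans (nL_le_approx AOX_space rho_norming LT lT eps0 _)).
  by lra.
rewrite -EFinD lee_fin ler_pdivrMr//.
have := ler_wpM2r (ltW e0) eps8; rewrite -/N; move: eps0 epsN N0.
clearbody eps N; nra.
Qed.
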